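(* There exist absolute constants $K,C,c>0$ such that for every prime power $q$, with $G=\mathrm{SL}(2,q)$, all but at most $K$ conjugacy classes $S$ of $G$ have the following property. Let $A\subseteq S$ with $|A|/|S|=\alpha>0$, and let $B,D\subseteq G$ with $|B|/|G|=\beta>0$ and $|D|/|G|=\gamma>0$. Pick $a,b,d$ uniformly and independently from $A,B,D$ respectively. Then for every $g\in G$, \[\left|\Pr[abd=g]-\frac1{|G|}\right|\le C(\alpha\beta\gamma)^{-1}|G|^{-c}\cdot\frac1{|G|}.\]
   Context: $\mathrm{SL}(2,q)$ is the group of $2\times2$ determinant-one matrices over $\mathbb F_q$. *)

(* Defs.v *)
From HB Require Import structures.
From mathcomp Require Import all_boot all_order all_algebra all_fingroup.
Set Implicit Arguments. Unset Strict Implicit. Unset Printing Implicit Defensive.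
Import GRing.Theory.
Local Open Scope ring_scope.

Definition SL2_set (F : finFieldType) : {set {'GL_2[F]}} :=
  [set g : {'GL_2[F]} | \det (GLval g) == 1%R].

Lemma SL2_group_set (F : finFieldType) : group_set (SL2_set F).
Proof.
apply/group_setP; split; first by rewrite inE GL_1E det1.
move=> x y; rewrite !inE => /eqP hx /eqP hy.
by rewrite GL_ME det_mulmx hx hy mulr1.
Qed.

Canonical SL2 (F : finFieldType) : {group {'GL_2[F]}} := Group (SL2_group_set F).

Definition triple_count (gT : finGroupType) (A B D : {set gT}) (g : gT) : nat :=
  #|[set t : gT * gT * gT |
      [&& t.1.1 \in A, t.1.2 \in B, t.2 \in D & ((t.1.1 * t.1.2 * t.2)%g == g)]]|.

(* Main.v *)
Require Import Defs.
From HB Require Import structures.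
From Stdlib Require Import Reals.
From mathcomp Require Import all_boot all_order all_algebra all_fingroup.
From mathcomp Require Import ring lra Rstruct.
Set Implicit Arguments. Unset Strict Implicit. Unset Printing Implicit Defensive.
Import Order.TTheory GRing.Theory Num.Theory.
Local Open Scope ring_scope.

(** Let f be the indicator of B minus its density and, for functions h, f on
    G = SL(2,q), let corr h f x be the inner product of h with the translate
    y |-> f (x y). Two applications of Cauchy-Schwarz bound the fourth power of
    the deviation of the number of triples by |D|^2 times the energy of A
    (the sum over x of the squared number of a in A with a x in A) times the
    sum of the squares of corr f f.

    The energy is small because, for non-scalar x, the conditions
    tr a = tr (a x) = t and det a = 1 cut out at most 2q matrices.  Non-scalar
    classes have at least |G|/(2q) elements, and the scalar classes are the at
    most two exceptions.

    The correlation sum is at most 27 (|G|/q) ||f||^4 for every f of mean zero;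
    this replaces the bound (q-1)/2 on the degrees of nontrivial complex
    representations.  If the averages of f over the cosets of the unipotent
    group U vanish, it follows from averaging over the diagonal torus, which
    acts on U = F_q by z |-> a^2 z, and Bessel's inequality for the lines of
    slope a^2 in U x U.  In general one subtracts from f its U-average and then
    the average over the opposite unipotent group, and what remains has square
    norm at most ||f||^2 / q by the Bruhat decomposition. *)

(** * Correlations *)

(** Expand the nonnegative sum of the squares of [H - c * \sum_i K i] with [c = 1 / (m * M)]. By
    [hK] and the bound on the clusters, the double sum of the products [K i * K j] is at most
    [m * M] times the sum to be estimated. *)
Lemma bessel_clusters (R : realFieldType) (X I : finType) (T : eqType)
    (D : pred X) (P : pred I) (s : I -> T) (H : X -> R) (K : I -> X -> R)
    (M : R) (m : nat) :
  0 < M -> (0 < m)%N ->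
  (forall i, P i -> (#|[set j | P j && (s j == s i)]| <= m)%N) ->
  (forall i j, P i -> P j -> \sum_(x | D x) K i x * K j x
     = if s j == s i then M * \sum_(x | D x) H x * K i x else 0) ->
  \sum_(i | P i) \sum_(x | D x) H x * K i x
    <= m%:R * M * \sum_(x | D x) H x ^+ 2.
Proof.
move=> M0 m0 hm hK; set T0 := fun i => \sum_(x | D x) H x * K i x.
have T_ge0 i : P i -> 0 <= T0 i.
  move=> Pi; have := hK i i Pi Pi; rewrite eqxx => e.
  rewrite -(pmulr_rge0 _ M0) -e; apply: sumr_ge0 => x _.
  by rewrite -expr2 sqr_ge0.
pose c : R := (m%:R * M)^-1.
have mM : 0 < m%:R * M by rewrite mulr_gt0 // ltr0n.
have c0 : 0 < c by rewrite invr_gt0.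
have dbl : \sum_(i | P i) \sum_(j | P j) \sum_(x | D x) K i x * K j x
    <= m%:R * M * \sum_(i | P i) T0 i.
  rewrite mulr_sumr; apply: ler_sum => i Pi.
  rewrite (eq_bigr (fun j => if s j == s i then M * T0 i else 0)); last first.
    by move=> j Pj; rewrite hK.
  rewrite -big_mkcondr sumr_const -[X in X <= _]mulr_natl -mulrA ler_wpM2r //.
    by rewrite mulr_ge0 ?T_ge0 // ltW.
  by rewrite ler_nat; apply: leq_trans (hm i Pi); rewrite cardsE.
have sq : 0 <= \sum_(x | D x) (H x - c * \sum_(i | P i) K i x) ^+ 2.
  by apply: sumr_ge0 => x _; rewrite sqr_ge0.
have expand : \sum_(x | D x) (H x - c * \sum_(i | P i) K i x) ^+ 2
   = \sum_(x | D x) H x ^+ 2 - 2 * c * \sum_(i | P i) T0 i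
     + c ^+ 2 * \sum_(i | P i) \sum_(j | P j) \sum_(x | D x) K i x * K j x.
  have -> : \sum_(i | P i) T0 i = \sum_(x | D x) H x * \sum_(i | P i) K i x.
    by rewrite exchange_big; apply: eq_bigr => x _; rewrite mulr_sumr.
  have -> : \sum_(i | P i) \sum_(j | P j) \sum_(x | D x) K i x * K j x
      = \sum_(x | D x) (\sum_(i | P i) K i x) ^+ 2.
    under eq_bigr do rewrite exchange_big.
    rewrite exchange_big; apply: eq_bigr => x _.
    by rewrite expr2 big_distrlr.
  rewrite !mulr_sumr -sumrN -!big_split /=; apply: eq_bigr => x _; ring.
rewrite expand in sq.
have : c ^+ 2 * \sum_(i | P i) \sum_(j | P j) \sum_(x | D x) K i x * K j x
   <= c * \sum_(i | P i) T0 i.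
  rewrite expr2 -mulrA ler_pM2l // -(ler_pM2l mM) mulrA /c divff ?gt_eqF //.
  by rewrite mul1r.
move=> h; have h2 : c * \sum_(i | P i) T0 i <= \sum_(x | D x) H x ^+ 2 by lra.
by rewrite -(ler_pM2l c0) mulrA /c mulVf ?gt_eqF // mul1r.
Qed.

Section Correlation.
Context (R : realFieldType) (gT : finGroupType) (G : {group gT}).
Implicit Types f h : gT -> R.

Definition corr h f (x : gT) : R := \sum_(y in G) h y * f (x * y)%g.
Definition norm2 f : R := \sum_(y in G) f y ^+ 2.

Lemma corr1 f : corr f f 1 = norm2 f.
Proof. by apply: eq_bigr => y _; rewrite mul1g expr2. Qed.

Lemma norm2_ge0 f : 0 <= norm2 f.
Proof. by apply: sumr_ge0 => y _; rewrite sqr_ge0. Qed.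

Lemma sum_mull f x : x \in G -> \sum_(y in G) f (x * y)%g = \sum_(y in G) f y.
Proof.
move=> xG; rewrite [RHS](reindex_inj (mulgI x)).
by apply: eq_bigl => y; rewrite groupMl.
Qed.

Lemma sum_mulr f x : x \in G -> \sum_(y in G) f (y * x)%g = \sum_(y in G) f y.
Proof.
move=> xG; rewrite [RHS](reindex_inj (mulIg x)).
by apply: eq_bigl => y; rewrite groupMr.
Qed.

Lemma corr_shift h f x y : x \in G ->
  \sum_(w in G) h (x * w)%g * f (y * w)%g = corr h f (y * x^-1)%g.
Proof.
move=> xG; rewrite -(sum_mull (fun w => h (x * w)%g * f (y * w)%g) (groupVr xG)).
by apply: eq_bigr => w _; rewrite !mulgA mulgV mul1g.
Qed.

Lemma corr_sym h f x : x \in G -> corr h f x = corr f h x^-1.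
Proof.
move=> xG; rewrite -[x^-1%g]mul1g -corr_shift //; apply: eq_bigr => w _.
by rewrite mul1g mulrC.
Qed.

Lemma norm2_mull f x : x \in G -> norm2 (fun y => f (x * y)%g) = norm2 f.
Proof. exact: (sum_mull (fun y => f y ^+ 2)). Qed.

Lemma sum_corr h f : \sum_(x in G) corr h f x = (\sum_(x in G) h x) * \sum_(x in G) f x.
Proof.
rewrite exchange_big mulr_suml; apply: eq_bigr => y yG.
by rewrite -mulr_sumr (sum_mulr f yG).
Qed.

Lemma corrDl h1 h2 f x :
  corr (fun y => h1 y + h2 y) f x = corr h1 f x + corr h2 f x.
Proof. by rewrite -big_split; apply: eq_bigr => y _; rewrite mulrDl. Qed.

(** Lagrange's identity: the double sum of [(a i * b j - a j * b i) ^+ 2] is twice the difference of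
    the two sides. *)
Lemma cauchy_schwarz_sum (I : finType) (P : pred I) (a b : I -> R) :
  (\sum_(i | P i) a i * b i) ^+ 2
    <= (\sum_(i | P i) a i ^+ 2) * \sum_(i | P i) b i ^+ 2.
Proof.
have : 0 <= \sum_(i | P i) \sum_(j | P j) (a i * b j - a j * b i) ^+ 2.
  by apply: sumr_ge0 => i _; apply: sumr_ge0 => j _; rewrite sqr_ge0.
have -> : \sum_(i | P i) \sum_(j | P j) (a i * b j - a j * b i) ^+ 2 =
  (\sum_(i | P i) a i ^+ 2) * (\sum_(i | P i) b i ^+ 2)
  + (\sum_(i | P i) b i ^+ 2) * (\sum_(i | P i) a i ^+ 2)
  - 2 * (\sum_(i | P i) a i * b i) ^+ 2.
  rewrite expr2 !big_distrlr mulr_sumr -sumrN -!big_split; apply: eq_bigr => i _.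
  rewrite /= mulr_sumr -sumrN -!big_split; apply: eq_bigr => j _ /=; ring.
by move=> h; lra.
Qed.

Lemma corr_sq_le h f x : x \in G -> corr h f x ^+ 2 <= norm2 h * norm2 f.
Proof.
move=> xG; rewrite -(norm2_mull f xG).
exact: (cauchy_schwarz_sum [in G] h (fun y => f (x * y)%g)).
Qed.

(** * Correlations along a homomorphic image of the additive group of [F] *)

Section Unipotent.
Context (F : finFieldType) (u : F -> gT).
Hypothesis uG : forall z, u z \in G.
Hypothesis uD : forall z w, u (z + w) = (u z * u w)%g.

Lemma u0 : u 0 = 1%g.
Proof. by apply: (mulgI (u 0)); rewrite -uD addr0 mulg1. Qed.

Lemma uN z : u (- z) = (u z)^-1%g.
Proof. by apply: (mulgI (u z)); rewrite -uD subrr u0 mulgV. Qed.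

Lemma corr_u h f z w :
  \sum_(x in G) h (u z * x)%g * f (u w * x)%g = corr h f (u (w - z)).
Proof. by rewrite corr_shift // uD uN. Qed.

Lemma corr_u_sym h f z : corr h f (u (- z)) = corr f h (u z).
Proof. by rewrite [RHS]corr_sym // uN. Qed.

Lemma prod_corr_u h1 f1 h2 f2 z z' w w' :
  \sum_(x in G) \sum_(y in G)
     (h1 (u z * x)%g * f1 (u z' * y)%g) * (h2 (u w * x)%g * f2 (u w' * y)%g)
  = corr h1 h2 (u (w - z)) * corr f1 f2 (u (w' - z')).
Proof.
rewrite -!corr_u big_distrlr; apply: eq_bigr => x _; apply: eq_bigr => y _ /=.
by rewrite mulrACA.
Qed.

Lemma sum_translate (psi : F -> R) w : \sum_z psi (z + w) = \sum_z psi z.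
Proof. by rewrite [RHS](reindex_inj (addIr w)). Qed.

Lemma sum_reflect (psi : F -> R) w : \sum_z psi (w - z) = \sum_z psi z.
Proof. by rewrite [RHS](reindex_inj (inj_comp (addrI w) oppr_inj)). Qed.

Lemma sum_opp (psi : F -> R) : \sum_z psi (- z) = \sum_z psi z.
Proof. by rewrite [RHS](reindex_inj oppr_inj). Qed.

Lemma sum_diff (psi : F -> R) :
  \sum_z \sum_w psi (w - z) = #|F|%:R * \sum_z psi z.
Proof.
under eq_bigr do rewrite sum_translate.
by rewrite sumr_const mulr_natl.
Qed.

(* Non-negativity of the squared norm of the antisymmetrised convolution of
   h and f over u, a Fourier-free form of Cauchy-Schwarz on characters of F. *)
Lemma sum_corr_sq_le h f :
  \sum_z corr h f (u z) ^+ 2 <= \sum_z corr h h (u z) * corr f f (u z).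
Proof.
(* The sign in [u (- z)] turns the cross terms into squares of [corr h f]; with [u z] in both
   factors they would pair the values at [v] and [- v]. *)
pose e z x y := h (u z * x)%g * f (u (- z)%R * y)%g - f (u z * x)%g * h (u (- z)%R * y)%g.
have : 0 <= \sum_(x in G) \sum_(y in G) (\sum_z e z x y) ^+ 2.
  by apply: sumr_ge0 => x _; apply: sumr_ge0 => y _; rewrite sqr_ge0.
have -> : \sum_(x in G) \sum_(y in G) (\sum_z e z x y) ^+ 2
  = \sum_z \sum_w \sum_(x in G) \sum_(y in G) e z x y * e w x y.
  rewrite [RHS](eq_bigr (fun z => \sum_(x in G) \sum_w \sum_(y in G) e z x y * e w x y));
    last by move=> z _; rewrite exchange_big.
  rewrite [RHS]exchange_big; apply: eq_bigr => x _ /=.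
  rewrite [RHS](eq_bigr (fun z => \sum_(y in G) \sum_w e z x y * e w x y));
    last by move=> z _; rewrite exchange_big.
  rewrite [RHS]exchange_big; apply: eq_bigr => y _ /=.
  by rewrite expr2 big_distrlr.
pose psi v := 2 * (corr h h (u v) * corr f f (u v)) -
  (corr h f (u v) ^+ 2 + corr h f (u (- v)) ^+ 2).
have term z w : \sum_(x in G) \sum_(y in G) e z x y * e w x y = psi (w - z).
  have N : - w - - z = - (w - z) by rewrite opprB addrC opprK.
  have := prod_corr_u h f h f z (- z) w (- w).
  have := prod_corr_u h f f h z (- z) w (- w).
  have := prod_corr_u f h h f z (- z) w (- w).
  have := prod_corr_u f h f h z (- z) w (- w).
  rewrite /psi !N !corr_u_sym => e1 e2 e3 e4.
  transitivity (corr f f (u (w - z)) * corr h h (u (w - z))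
     - corr f h (u (w - z)) * corr f h (u (w - z))
     - corr h f (u (w - z)) * corr h f (u (w - z))
     + corr h h (u (w - z)) * corr f f (u (w - z))); last by ring.
  rewrite -e1 -e2 -e3 -e4 -!sumrN -!big_split; apply: eq_bigr => x _ /=.
  rewrite -!sumrN -!big_split; apply: eq_bigr => y _ /=; rewrite /e; ring.
under eq_bigr => z _ do under eq_bigr => w _ do rewrite term.
rewrite sum_diff pmulr_rge0 ?ltr0n; last by apply/card_gt0P; exists 0.
rewrite /psi big_split /= sumrN -mulr_sumr big_split /=.
rewrite (sum_opp (fun v => corr h f (u v) ^+ 2)); lra.
Qed.

Lemma card_sqr_eq_le (a : F) :
  (#|[set b : F | (b != 0)%R && (b ^+ 2 == a ^+ 2)%R]| <= 2)%N.
Proof.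
apply: leq_trans (subset_leq_card (_ : _ \subset [set a; - a])) _.
  by apply/subsetP => b; rewrite !inE eqf_sqr => /andP[].
by rewrite cards2; case: (_ != _).
Qed.

(* On the product F x F the averages of h (x) f over distinct lines through
   the origin are orthogonal, since two such lines span the plane. *)
Lemma sum_corr_scaled_le h f :
  (forall x, x \in G -> \sum_z h (u z * x)%g = 0) ->
  \sum_(a | a != 0) \sum_z corr h h (u z) * corr f f (u (a ^+ 2 * z))
    <= 2 * #|F|%:R * (norm2 h * norm2 f).
Proof.
move=> h0.
have h0' : \sum_z corr h h (u z) = 0.
  rewrite exchange_big big1 // => x xG; rewrite -mulr_sumr.
  by rewrite h0 // mulr0.
pose H (p : gT * gT) := h p.1 * f p.2.
pose K (a : F) (p : gT * gT) := \sum_z h (u z * p.1)%g * f (u (a ^+ 2 * z)%R * p.2)%g.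
pose D (p : gT * gT) := (p.1 \in G) && (p.2 \in G).
have HK a : \sum_(p | D p) H p * K a p
   = \sum_z corr h h (u z) * corr f f (u (a ^+ 2 * z)).
  rewrite -(pair_big [in G] [in G] (fun x y => H (x, y) * K a (x, y))) /=.
  rewrite [RHS](eq_bigr (fun z => \sum_(x in G) \sum_(y in G)
    (h (u 0 * x)%g * f (u 0 * y)%g) * (h (u z * x)%g * f (u (a ^+ 2 * z)%R * y)%g)));
    last by move=> z _; rewrite prod_corr_u !subr0.
  rewrite u0.
  rewrite [RHS]exchange_big; apply: eq_bigr => x _ /=.
  rewrite [RHS]exchange_big; apply: eq_bigr => y _ /=.
  by rewrite /H /K mulr_sumr; apply: eq_bigr => z _; rewrite !mul1g.
have KK a b : \sum_(p | D p) K a p * K b p = \sum_z \sum_w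
    corr h h (u (w - z)) * corr f f (u (b ^+ 2 * w - a ^+ 2 * z)).
  rewrite -(pair_big [in G] [in G] (fun x y => K a (x, y) * K b (x, y))) /=.
  under [RHS]eq_bigr => z _ do
    under eq_bigr => w _ do rewrite -prod_corr_u.
  rewrite [RHS](eq_bigr (fun z => \sum_(x in G) \sum_w \sum_(y in G)
    h (u z * x)%g * f (u (a ^+ 2 * z)%R * y)%g *
    (h (u w * x)%g * f (u (b ^+ 2 * w)%R * y)%g)));
    last by move=> z _; rewrite exchange_big.
  rewrite [RHS]exchange_big; apply: eq_bigr => x _ /=.
  rewrite [RHS](eq_bigr (fun z => \sum_(y in G) \sum_w
    h (u z * x)%g * f (u (a ^+ 2 * z)%R * y)%g *
    (h (u w * x)%g * f (u (b ^+ 2 * w)%R * y)%g)));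
    last by move=> z _; rewrite exchange_big.
  rewrite [RHS]exchange_big; apply: eq_bigr => y _ /=.
  by rewrite /K big_distrlr.
have HH : \sum_(p | D p) H p ^+ 2 = norm2 h * norm2 f.
  rewrite -(pair_big [in G] [in G] (fun x y => H (x, y) ^+ 2)) /=.
  rewrite big_distrlr; apply: eq_bigr => x _; apply: eq_bigr => y _.
  by rewrite /H /= exprMn.
rewrite -HH; under eq_bigr do rewrite -HK.
have q0 : 0 < #|F|%:R :> R by rewrite ltr0n; apply/card_gt0P; exists 0.
(* [K a] sums over the line of slope [a ^+ 2], so [M] is [#|F|]; at most two [a] share a slope, so
   [m] is 2. *)
apply: (bessel_clusters (s := fun a : F => a ^+ 2)) => //.
  by move=> a _; apply: card_sqr_eq_le.
move=> a b _ _; rewrite KK; have [e|ne] := eqVneq.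
  rewrite HK -sum_diff; apply: eq_bigr => z _; apply: eq_bigr => w _.
  by rewrite e mulrBr.
(* For distinct slopes put [v = w - z]: the argument of [corr f f] becomes
   [(b ^+ 2 - a ^+ 2) * w + a ^+ 2 * v], which runs over all of [F] as [w] does. The double sum
   factors, and [h0'] makes it vanish. *)
rewrite exchange_big /=.
under eq_bigr => w _ do rewrite -(sum_reflect _ w).
rewrite exchange_big /=.
have d0 : b ^+ 2 - a ^+ 2 != 0 by rewrite subr_eq0.
transitivity (\sum_v corr h h (u v) * \sum_w corr f f (u w)); last first.
  by rewrite -mulr_suml h0' mul0r.
apply: eq_bigr => v _; rewrite mulr_sumr.
rewrite [RHS](reindex_inj (addIr (a ^+ 2 * v))).
rewrite [RHS](reindex_inj (mulfI d0)) /=; apply: eq_bigr => w _.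
by congr (corr h h (u _) * corr f f (u _)); ring.
Qed.
End Unipotent.
End Correlation.

(** * Quasirandomness *)

Section Quasirandom.
Context (R : realFieldType) (gT : finGroupType) (G : {group gT}).
Context (F : finFieldType) (u : F -> gT).
Hypothesis uG : forall z, u z \in G.
Hypothesis uD : forall z w, u (z + w) = (u z * u w)%g.
Implicit Types f g h : gT -> R.

Local Notation q := (#|F|%:R : R).

Lemma card_field_gt0 : 0 < q.
Proof. by rewrite ltr0n; apply/card_gt0P; exists 0. Qed.

Lemma card_field_neq0 : q != 0.
Proof. by rewrite gt_eqF // card_field_gt0. Qed.

Definition uavg f (x : gT) : R := q^-1 * \sum_z f (u z * x)%g.

Lemma uavg_inv f w x : uavg f (u w * x)%g = uavg f x.
Proof.
rewrite /uavg -(sum_translate (fun z => f (u z * x)%g) w); congr (_ * _).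
by apply: eq_bigr => z _; rewrite uD mulgA.
Qed.

Lemma uavg_compl f x : \sum_z (f (u z * x)%g - uavg f (u z * x)%g) = 0.
Proof.
rewrite big_split /= sumrN [X in _ - X](eq_bigr (fun=> uavg f x)) => [|z _]; last first.
  by rewrite uavg_inv.
by rewrite sumr_const -[_ *+ _]mulr_natl mulrA divff ?card_field_neq0 // mul1r subrr.
Qed.

Lemma sum_uavg f : \sum_(x in G) uavg f x = \sum_(x in G) f x.
Proof.
rewrite -mulr_sumr exchange_big.
under eq_bigr do rewrite (sum_mull f) //.
by rewrite sumr_const -[X in _ * X]mulr_natl mulKf ?card_field_neq0.
Qed.

(** Expanding the square of the average produces the correlations at [u (w - z)], and every
    difference occurs [q] times. *)
Lemma norm2_uavg f : norm2 G (uavg f) = q^-1 * \sum_z corr G f f (u z).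
Proof.
have <- : q^-1 * \sum_z \sum_w corr G f f (u (w - z)) = \sum_z corr G f f (u z).
  by rewrite (sum_diff (fun v => corr G f f (u v))) mulKf ?card_field_neq0.
have -> : \sum_z \sum_w corr G f f (u (w - z))
    = \sum_(x in G) (\sum_z f (u z * x)%g) ^+ 2.
  transitivity (\sum_z \sum_(x in G) \sum_w f (u z * x)%g * f (u w * x)%g).
    apply: eq_bigr => z _; rewrite [RHS]exchange_big; apply: eq_bigr => w _.
    by rewrite -(corr_u uG uD).
  by rewrite exchange_big; apply: eq_bigr => x _; rewrite expr2 big_distrlr.
rewrite !mulr_sumr; apply: eq_bigr => x _.
by rewrite /uavg exprMn expr2 mulrA.
Qed.

(** Pythagoras: [uavg] is an orthogonal projection, which is the content of [e]. *)
Lemma norm2_sub_uavg f :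
  norm2 G (fun x => f x - uavg f x) = norm2 G f - norm2 G (uavg f).
Proof.
have e : \sum_(x in G) f x * uavg f x = norm2 G (uavg f).
  rewrite norm2_uavg exchange_big mulr_sumr; apply: eq_bigr => x _ /=.
  by rewrite -mulr_sumr mulrCA.
rewrite /norm2 -[X in _ - X]/(norm2 G (uavg f)).
transitivity (norm2 G f - 2 * (\sum_(x in G) f x * uavg f x) + norm2 G (uavg f)).
  rewrite mulr_sumr -sumrN -!big_split; apply: eq_bigr => x _ /=; ring.
by rewrite e /norm2; ring.
Qed.

Lemma norm2_uavg_le f : norm2 G (uavg f) <= norm2 G f.
Proof. by rewrite -subr_ge0 -norm2_sub_uavg norm2_ge0. Qed.

Lemma norm2_sub_uavg_le f : norm2 G (fun x => f x - uavg f x) <= norm2 G f.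
Proof. by rewrite norm2_sub_uavg gerBl norm2_ge0. Qed.

Section Torus.
Context (t : F -> gT).
Hypothesis tG : forall a, a != 0 -> t a \in G.
Hypothesis tu : forall a z, a != 0 -> (t a * u z = u (a ^+ 2 * z)%R * t a)%g.

(** The sum over [G] does not change when [x] is replaced by [x * t a * u z]. The sum over [z] is
    bounded by [sum_corr_sq_le], and the sum over [a] then brings in all slopes [a ^+ 2], as in
    [sum_corr_scaled_le]. *)
Lemma sum_corr_sq_unipotent_le h f :
  (forall x, x \in G -> \sum_z h (u z * x)%g = 0) ->
  (#|F|.-1)%:R * \sum_(x in G) corr G h f x ^+ 2
    <= 2 * #|G|%:R * (norm2 G h * norm2 G f).
Proof.
move=> h0.
have step x : x \in G ->
    \sum_(a | a != 0) \sum_z corr G h f (x * t a * u z)%g ^+ 2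
      <= 2 * q * (norm2 G h * norm2 G f).
  move=> xG; pose fx y := f (x * y)%g.
  have -> : norm2 G f = norm2 G fx by rewrite norm2_mull.
  apply: le_trans (sum_corr_scaled_le uG uD fx h0).
  apply: ler_sum => a a0; pose fa y := fx (t a * y)%g.
  have -> : \sum_z corr G h f (x * t a * u z)%g ^+ 2 = \sum_z corr G h fa (u z) ^+ 2.
    apply: eq_bigr => z _; congr (_ ^+ 2); apply: eq_bigr => y _.
    by rewrite /fa /fx !mulgA.
  apply: le_trans (sum_corr_sq_le uG uD h fa) _.
  (* Moving [u z] past [t a] by [tu] turns [corr G fa fa (u z)] into
     [corr G fx fx (u (a ^+ 2 * z))]. *)
  rewrite le_eqVlt; apply/orP; left; apply/eqP; apply: eq_bigr => z _; congr (_ * _).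
  rewrite /corr -[RHS](sum_mull _ (tG a0)); apply: eq_bigr => y _.
  by rewrite /fa !mulgA tu.
have tot : \sum_(x in G) \sum_(a | a != 0) \sum_z corr G h f (x * t a * u z)%g ^+ 2
    = q * ((#|F|.-1)%:R * \sum_(x in G) corr G h f x ^+ 2).
  rewrite exchange_big /= (eq_bigr (fun=> q * \sum_(x in G) corr G h f x ^+ 2)).
    by rewrite sumr_const cardC1 -[LHS]mulr_natl mulrCA.
  move=> a a0; rewrite exchange_big /=.
  rewrite (eq_bigr (fun=> \sum_(x in G) corr G h f x ^+ 2)).
    by rewrite sumr_const -[LHS]mulr_natl.
  move=> z _; rewrite -(sum_mulr (fun x => corr G h f x ^+ 2) (groupM (tG a0) (uG z))).
  by apply: eq_bigr => x _; rewrite mulgA.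
rewrite -(ler_pM2l card_field_gt0) -tot.
apply: le_trans (ler_sum _ step) _.
rewrite sumr_const -[leLHS]mulr_natl; lra.
Qed.

Section BigCell.
Context (B : {group gT}) (w : gT).
Hypothesis sBG : B \subset G.
Hypothesis wG : w \in G.
Hypothesis sum_big_cell : forall psi : gT -> R,
  \sum_(y in G :\: B) psi y
    = \sum_(z | z != 0) \sum_s \sum_s' psi (u s * (w * u z * w^-1) * u s')%g.

(** Up to the factor [#|B|] this is the sum over [x] of the squared sums of [g] over the cosets
    [B x]. *)
Lemma sum_corr_subgroup_ge0 g : 0 <= \sum_(b in B) corr G g g b.
Proof.
rewrite -(pmulr_rge0 _ (_ : 0 < #|B|%:R)) ?ltr0n ?cardG_gt0 //.
have -> : #|B|%:R * \sum_(b in B) corr G g g b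
    = \sum_(x in G) (\sum_(b in B) g (b * x)%g) ^+ 2.
  transitivity (\sum_(b in B) \sum_(b' in B) corr G g g (b' * b^-1)%g).
    rewrite [RHS](eq_bigr (fun=> \sum_(b in B) corr G g g b)) => [|b bB].
      by rewrite sumr_const -[RHS]mulr_natl.
    by rewrite (sum_mulr (corr G g g)) ?groupV.
  transitivity (\sum_(b in B) \sum_(x in G) \sum_(b' in B) g (b * x)%g * g (b' * x)%g).
    apply: eq_bigr => b bB; rewrite [RHS]exchange_big; apply: eq_bigr => b' _.
    by rewrite corr_shift // (subsetP sBG).
  by rewrite exchange_big; apply: eq_bigr => x _; rewrite expr2 big_distrlr.
by apply: sumr_ge0 => x _; rewrite sqr_ge0.
Qed.

(* By invariance, the correlations of g on the big cell G \ B reduce to those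
   on the opposite unipotent group, and they sum to minus those on B. *)
Lemma norm2_uavg_opposite_le g :
  (forall z x, g (u z * x)%g = g x) -> \sum_(x in G) g x = 0 ->
  q * norm2 G (uavg (fun x => g (w * x)%g)) <= norm2 G g.
Proof.
move=> gu g0; rewrite norm2_uavg mulVKf ?card_field_neq0 //.
rewrite (eq_bigr (fun z => corr G g g (w * u z * w^-1)%g)) => [|z _]; last first.
  by rewrite -corr_shift //; apply: eq_bigr => y _; rewrite mulgA.
rewrite (bigD1 0) //= (u0 uD) mulg1 mulgV corr1 gerDl.
(* The factor [q * q] counts the pairs [(s, s')], whose choice does not affect the correlation. *)
have q2 : 0 < q * q by rewrite mulr_gt0 // card_field_gt0.
rewrite -(pmulr_rle0 _ q2).
have -> : q * q * \sum_(z | z != 0) corr G g g (w * u z * w^-1)%g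
    = \sum_(y in G :\: B) corr G g g y.
  rewrite sum_big_cell mulr_sumr; apply: eq_bigr => z _.
  rewrite [RHS](eq_bigr (fun=> q * corr G g g (w * u z * w^-1)%g)).
    by rewrite sumr_const -[RHS]mulr_natl mulrA.
  move=> s _; rewrite [LHS](eq_bigr (fun=> corr G g g (w * u z * w^-1)%g)).
    by rewrite sumr_const -[LHS]mulr_natl.
  move=> s' _; rewrite /corr -[RHS](sum_mull _ (uG s')); apply: eq_bigr => y _.
  by rewrite gu -!mulgA gu !mulgA.
have := sum_corr_subgroup_ge0 g.
have : \sum_(y in G) corr G g g y = 0 by rewrite sum_corr g0 mulr0.
rewrite (big_setID B) /= (setIidPr sBG) => e h; lra.
Qed.

Lemma sum_corr_sq_quasirandom f : \sum_(x in G) f x = 0 ->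
  q * \sum_(x in G) corr G f f x ^+ 2 <= 27 * #|G|%:R * norm2 G f ^+ 2.
Proof.
(* [f] splits as [f1 + g], and the translate [g'] of [g] as [g1 + k]; [f1] and [g1] have vanishing
   averages along [u], and [k] is small in norm. *)
move=> f0; pose g := uavg f; pose g' x := g (w * x)%g; pose k := uavg g'.
pose f1 x := f x - g x; pose g1 x := g' x - k x.
have N0 := norm2_ge0 G f; have n0 : 0 <= #|G|%:R :> R by rewrite ler0n.
(* This trades [#|F|.-1] for [q] at the cost of a factor 2, so the constant 2 of the unipotent bound
   becomes 4. *)
have q_le : q <= 2 * (#|F|.-1)%:R.
  rewrite -natrM ler_nat mul2n -addnn; have : (1 < #|F|)%N := card_finNzRing_gt1 F.
  by case: #|F| => [|[|m]] //= _; rewrite addSn ltnS leq_addl.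
have bound h : (forall x, x \in G -> \sum_z h (u z * x)%g = 0) ->
    norm2 G h <= norm2 G f ->
    q * \sum_(x in G) corr G h f x ^+ 2 <= 4 * #|G|%:R * norm2 G f ^+ 2.
  move=> h0 hN; have S0 : 0 <= \sum_(x in G) corr G h f x ^+ 2.
    by apply: sumr_ge0 => x _; rewrite sqr_ge0.
  have := sum_corr_sq_unipotent_le f h0.
  have : norm2 G h * norm2 G f <= norm2 G f ^+ 2 by rewrite expr2 ler_wpM2r.
  move=> /(ler_wpM2l n0) e1 e2.
  have := ler_wpM2r S0 q_le; lra.
have gN : norm2 G g <= norm2 G f := norm2_uavg_le f.
have g'N : norm2 G g' <= norm2 G f by rewrite norm2_mull.
have bf1 := bound f1 (fun x _ => uavg_compl f x) (norm2_sub_uavg_le f).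
have bg1 := bound g1 (fun x _ => uavg_compl g' x)
  (le_trans (norm2_sub_uavg_le g') g'N).
(* For [k] the pointwise Cauchy-Schwarz bound suffices: the gain of [q] is already in its norm. *)
have bk : q * \sum_(x in G) corr G k f x ^+ 2 <= #|G|%:R * norm2 G f ^+ 2.
  have kN : q * norm2 G k <= norm2 G f.
    by apply: le_trans gN; apply: norm2_uavg_opposite_le;
      [exact: uavg_inv | rewrite sum_uavg].
  have : \sum_(x in G) corr G k f x ^+ 2 <= #|G|%:R * (norm2 G k * norm2 G f).
    rewrite [leRHS]mulr_natl -sumr_const; apply: ler_sum => x xG.
    exact: corr_sq_le.
  move=> /(ler_wpM2l (ltW card_field_gt0)) e.
  by have := ler_wpM2l n0 (ler_wpM2r N0 kN); rewrite expr2; lra.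
have sh h : \sum_(x in G) corr G h f (x * w)%g ^+ 2 = \sum_(x in G) corr G h f x ^+ 2.
  exact: (sum_mulr (fun x => corr G h f x ^+ 2)).
have dec x : x \in G ->
    corr G f f x = corr G f1 f x + corr G g1 f (x * w)%g + corr G k f (x * w)%g.
  move=> xG; rewrite -addrA -corrDl.
  have -> : corr G (fun y => g1 y + k y) f (x * w)%g = corr G g f x.
    rewrite [RHS]/corr -(sum_mull _ wG); apply: eq_bigr => y _.
    by rewrite /g1 subrK mulgA.
  by rewrite -corrDl; apply: eq_bigr => y _; rewrite /f1 subrK.
(* The square of a sum of three terms is at most 3 times the sum of their squares; the bounds 4, 4
   and 1 then give 27 = 3 (4 + 4 + 1). *)
have : \sum_(x in G) corr G f f x ^+ 2 <= 3 * (\sum_(x in G) corr G f1 f x ^+ 2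
   + \sum_(x in G) corr G g1 f x ^+ 2 + \sum_(x in G) corr G k f x ^+ 2).
  rewrite -(sh g1) -(sh k) -!big_split mulr_sumr; apply: ler_sum => x xG /=.
  rewrite dec //; set a := corr _ f1 _ _; set b := corr _ g1 _ _; set c := corr _ k _ _.
  have := sqr_ge0 (a - b); have := sqr_ge0 (a - c); have := sqr_ge0 (b - c); lra.
move=> /(ler_wpM2l (ltW card_field_gt0)); lra.
Qed.

End BigCell.
End Torus.
End Quasirandom.

(** * Counting triples *)

(** A triple is parametrised by [a] and [y = a * b]; the equation then forces [d = y^-1 * g]. *)
Lemma triple_countE (gT : finGroupType) (A B D : {set gT}) (g : gT) :
  triple_count A B D g
    = (\sum_(a in A) \sum_y (((a^-1 * y)%g \in B) && ((y^-1 * g)%g \in D)))%N.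
Proof.
pose P (p : gT * gT) := [&& p.1 \in A, (p.1^-1 * p.2)%g \in B & (p.2^-1 * g)%g \in D].
pose phi (p : gT * gT) := (p.1, (p.1^-1 * p.2)%g, (p.2^-1 * g)%g).
have phi_inj : injective phi.
  by move=> [a y] [a' y']; rewrite /phi /= => -[<- /mulgI <-].
rewrite /triple_count (_ : [set t | _] = phi @: [set p | P p]).
  rewrite card_imset // -sum1dep_card big_mkcond /=.
  rewrite -(pair_bigA_idem _ (fun a y => if P (a, y) then 1 else 0)%N) //=.
  rewrite [RHS]big_mkcond; apply: eq_bigr => a _ /=; rewrite /P /=.
  case: (a \in A) => /=; last by rewrite big1.
  by apply: eq_bigr => y _; case: (_ && _).
apply/setP => -[[a b] d]; rewrite inE /=; apply/idP/imsetP.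
  case/and4P => aA bB dD /eqP e; exists (a, (a * b)%g).
    by rewrite inE /P /= mulKg aA bB -e mulKg dD.
  by rewrite /phi /= mulKg -e mulKg.
case=> -[a' y]; rewrite inE /P /= => /and3P[aA yB yD] [-> -> ->].
by rewrite aA yB yD /= mulKVg mulKVg eqxx.
Qed.

Section Mixing.
Context (R : realFieldType) (gT : finGroupType) (G : {group gT}).

Lemma sum_indicator (B : {set gT}) : B \subset G ->
  \sum_(y in G) (y \in B)%:R = #|B|%:R :> R.
Proof.
move=> sBG; rewrite -natr_sum -sum1_card big_mkcond [X in _ = X%:R]big_mkcond /=.
congr (_ %:R); apply: eq_bigr => y _.
by have [/(subsetP sBG) ->|] := boolP (y \in B); last by case: ifP.
Qed.

Lemma norm2_indicator_balanced (B : {set gT}) : B \subset G ->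
  let f y := (y \in B)%:R - #|B|%:R / #|G|%:R : R in
  \sum_(y in G) f y = 0 /\ norm2 G f <= #|B|%:R.
Proof.
move=> sBG f; have n0 : 0 < #|G|%:R :> R by rewrite ltr0n cardG_gt0.
have s1 := sum_indicator sBG.
have s2 : \sum_(y in G) (#|B|%:R / #|G|%:R) = #|B|%:R :> R.
  by rewrite sumr_const -[LHS]mulr_natr divfK ?gt_eqF.
split; first by rewrite sumrB s1 s2 subrr.
have -> : norm2 G f = \sum_(y in G) (y \in B)%:R
    - 2 * (#|B|%:R / #|G|%:R) * (\sum_(y in G) (y \in B)%:R)
    + (#|B|%:R / #|G|%:R) * \sum_(y in G) (#|B|%:R / #|G|%:R).
  rewrite !mulr_sumr -sumrN -!big_split; apply: eq_bigr => y _ /=.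
  by rewrite /f; case: (y \in B) => /=; ring.
rewrite s1 s2; set b := _ / _.
have : 0 <= b * #|B|%:R by rewrite mulr_ge0 ?divr_ge0 ?ler0n.
lra.
Qed.

Lemma triple_count_dev_le (Q : R) (A B D : {set gT}) (g : gT) :
  0 <= Q ->
  (forall f : gT -> R, \sum_(x in G) f x = 0 ->
     \sum_(x in G) corr G f f x ^+ 2 <= Q * norm2 G f ^+ 2) ->
  A \subset G -> B \subset G -> D \subset G -> g \in G ->
  ((triple_count A B D g)%:R - #|A|%:R * #|B|%:R * #|D|%:R / #|G|%:R) ^+ 4
   <= #|D|%:R ^+ 2 * (\sum_(x in G) #|[set a in A | (a * x)%g \in A]|%:R ^+ 2)
      * (Q * #|B|%:R ^+ 2).
Proof.
move=> Q0 hQ sAG sBG sDG gG.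
pose f y : R := (y \in B)%:R - #|B|%:R / #|G|%:R.
have [f0 fN] : \sum_(y in G) f y = 0 /\ norm2 G f <= #|B|%:R :=
  norm2_indicator_balanced sBG.
pose h y : R := ((y^-1 * g)%g \in D)%:R.
pose phi y : R := \sum_(a in A) f (a^-1 * y)%g.
pose r x : R := #|[set a in A | (a * x)%g \in A]|%:R.
have n0 : 0 < #|G|%:R :> R by rewrite ltr0n cardG_gt0.
have AG a : a \in A -> a \in G by move/(subsetP sAG).
have sh : \sum_(y in G) h y = #|D|%:R.
  rewrite -(sum_mull h gG) (reindex_inj invg_inj) /=.
  under eq_bigl do rewrite groupV.
  rewrite -(sum_indicator sDG); apply: eq_bigr => y _.
  by rewrite /h invMg invgK mulgKV.
(* The mean of the indicator of [B] contributes exactly the main term, so only the balanced part [f]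
   is left in the deviation. *)
have dev : (triple_count A B D g)%:R - #|A|%:R * #|B|%:R * #|D|%:R / #|G|%:R
    = \sum_(y in G) h y * phi y.
  have -> : \sum_(y in G) h y * phi y
      = \sum_(a in A) \sum_(y in G) h y * f (a^-1 * y)%g.
    by rewrite exchange_big; apply: eq_bigr => y _; rewrite mulr_sumr.
  have e : #|A|%:R * #|B|%:R * #|D|%:R / #|G|%:R
     = \sum_(a in A) \sum_(y in G) h y * (#|B|%:R / #|G|%:R) :> R.
    by rewrite sumr_const -mulr_suml sh -[RHS]mulr_natl; field; rewrite gt_eqF.
  rewrite e triple_countE natr_sum -sumrB; apply: eq_bigr => a aA.
  rewrite natr_sum (bigID [in G]) /= [X in _ + X - _]big1 ?addr0 => [|y yG]; last first.
    case: (boolP (_ \in B)) => //= /(subsetP sBG).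
    by rewrite (groupMl y (groupVr (AG _ aA))) (negbTE yG).
  rewrite -sumrB; apply: eq_bigr => y _; rewrite /f /h.
  by case: (_ \in B); case: (_ \in D) => /=; ring.
(* The first Cauchy-Schwarz removes [h], whose values are 0 and 1, so that its squares sum to
   [#|D|]. *)
have c1 : (\sum_(y in G) h y * phi y) ^+ 2 <= #|D|%:R * \sum_(y in G) phi y ^+ 2.
  apply: le_trans (cauchy_schwarz_sum _ _ _) _.
  rewrite (eq_bigr h) ?sh // => y _.
  by rewrite /h; case: (_ \in D); rewrite ?expr1n ?expr0n.
(* In the expanded square put [a = a' * x]: the number of pairs in [A] with quotient [x] is
   [r x]. *)
have phi2 : \sum_(y in G) phi y ^+ 2 = \sum_(x in G) r x * corr G f f x.
  transitivity (\sum_(a in A) \sum_(a' in A) corr G f f (a'^-1 * a)%g).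
    transitivity (\sum_(a in A) \sum_(y in G) \sum_(a' in A)
        f (a^-1 * y)%g * f (a'^-1 * y)%g).
      by rewrite exchange_big; apply: eq_bigr => y _; rewrite expr2 big_distrlr.
    apply: eq_bigr => a aA; rewrite [LHS]exchange_big; apply: eq_bigr => a' _ /=.
    by rewrite corr_shift ?groupV ?AG // invgK.
  rewrite exchange_big.
  transitivity (\sum_(a in A) \sum_(x in G) ((a * x)%g \in A)%:R * corr G f f x).
    apply: eq_bigr => a aA; rewrite (reindex_inj (mulgI a)) /= big_mkcond [RHS]big_mkcond.
    apply: eq_bigr => x _; rewrite mulKg.
    have [axA|] := boolP (_ \in A); last by case: ifP => _; rewrite ?mul0r.
    by rewrite -(groupMl x (AG _ aA)) (AG _ axA) mul1r.
  rewrite exchange_big; apply: eq_bigr => x _ /=; rewrite -mulr_suml; congr (_ * _).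
  rewrite -natr_sum /r -sum1dep_card; congr (_ %:R); rewrite [RHS]big_mkcondr /=.
  by apply: eq_bigr => a _; case: (_ \in A).
(* The second Cauchy-Schwarz separates the energy of [A] from the correlations; it applies to the
   square of the first bound, hence the fourth power. *)
rewrite dev (_ : 4 = 2 * 2)%N // exprM.
apply: (@le_trans _ _ ((#|D|%:R * \sum_(y in G) phi y ^+ 2) ^+ 2)).
  rewrite ler_sqr ?nnegrE ?sqr_ge0 // mulr_ge0 ?ler0n //.
  by apply: sumr_ge0 => y _; rewrite sqr_ge0.
rewrite exprMn -mulrA ler_wpM2l ?sqr_ge0 // phi2.
apply: le_trans (cauchy_schwarz_sum _ _ _) _.
rewrite ler_wpM2l //; first by apply: sumr_ge0 => x _; rewrite sqr_ge0.
apply: le_trans (hQ f f0) _; rewrite ler_wpM2l // ler_sqr ?nnegrE ?norm2_ge0 //.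
Qed.
End Mixing.

(** * The group SL(2,q) *)

Section SL2Elements.
Context (F : finFieldType).
Implicit Types (a b c d z s : F) (x y g : {'GL_2[F]}).

Definition mx2 a b c d : 'M[F]_2 :=
  \matrix_(i, j) if i == 0 then if j == 0 then a else b
                 else if j == 0 then c else d.

Lemma det_mx2 (M : 'M[F]_2) : \det M = M 0 0 * M 1 1 - M 0 1 * M 1 0.
Proof.
rewrite (expand_det_row M 0) !big_ord_recl big_ord0 /cofactor !det_mx11 !mxE /=.
have -> : lift 0 0 = 1 :> 'I_2 by apply: val_inj.
have -> : lift 1 0 = 0 :> 'I_2 by apply: val_inj.
rewrite expr0 expr1; ring.
Qed.

Lemma mx2_eta (M : 'M[F]_2) : M = mx2 (M 0 0) (M 0 1) (M 1 0) (M 1 1).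
Proof.
have I2 (i : 'I_2) : i = 0 \/ i = 1.
  by case: i => -[|[|//]] ?; [left|right]; apply: val_inj.
apply/matrixP => i j; rewrite mxE.
by have [->|->] := I2 i; have [->|->] := I2 j.
Qed.

Lemma mulmx2 a b c d a' b' c' d' :
  mx2 a b c d *m mx2 a' b' c' d'
    = mx2 (a * a' + b * c') (a * b' + b * d') (c * a' + d * c') (c * b' + d * d').
Proof.
by rewrite [LHS]mx2_eta; congr mx2; rewrite !mxE !big_ord_recl big_ord0 !mxE /= addr0.
Qed.

(** The default is the identity, taken when the matrix is singular; [val_sl2] recovers the entries
    under determinant one. *)
Definition sl2 a b c d : {'GL_2[F]} := insubd (1%g : {'GL_2[F]}) (mx2 a b c d).

Lemma val_sl2 a b c d : a * d - b * c = 1 -> GLval (sl2 a b c d) = mx2 a b c d.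
Proof.
move=> h; apply: insubdK.
by rewrite -[_ \in _]/(_ \in unitmx) unitmxE det_mx2 !mxE /= h unitr1.
Qed.

Lemma GL2_eqP x y :
  GLval x 0 0 = GLval y 0 0 -> GLval x 0 1 = GLval y 0 1 ->
  GLval x 1 0 = GLval y 1 0 -> GLval x 1 1 = GLval y 1 1 -> x = y.
Proof.
move=> e1 e2 e3 e4; apply: val_inj.
by rewrite /= (mx2_eta (GLval x)) (mx2_eta (GLval y)) e1 e2 e3 e4.
Qed.

Lemma in_SL2 x :
  (x \in SL2 F) = (GLval x 0 0 * GLval x 1 1 - GLval x 0 1 * GLval x 1 0 == 1).
Proof. by rewrite inE det_mx2. Qed.

Lemma SL2_det x : x \in SL2 F ->
  GLval x 0 0 * GLval x 1 1 - GLval x 0 1 * GLval x 1 0 = 1.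
Proof. by rewrite in_SL2 => /eqP. Qed.

Lemma sl2_in a b c d : a * d - b * c = 1 -> sl2 a b c d \in SL2 F.
Proof. by move=> h; rewrite in_SL2 val_sl2 // !mxE /= h. Qed.

Lemma SL2_eta x : x \in SL2 F ->
  x = sl2 (GLval x 0 0) (GLval x 0 1) (GLval x 1 0) (GLval x 1 1).
Proof.
by move=> /SL2_det h; apply: val_inj; rewrite /= val_sl2 // -mx2_eta.
Qed.

Lemma sl2M a b c d a' b' c' d' : a * d - b * c = 1 -> a' * d' - b' * c' = 1 ->
  (sl2 a b c d * sl2 a' b' c' d')%g
    = sl2 (a * a' + b * c') (a * b' + b * d') (c * a' + d * c') (c * b' + d * d').
Proof.
move=> h h'; apply: val_inj.
rewrite -[LHS]/(GLval (sl2 a b c d) *m GLval (sl2 a' b' c' d')).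
rewrite -[RHS]/(GLval _) !val_sl2 ?mulmx2 //.
by rewrite -[1]mulr1 -{1}h -h'; ring.
Qed.

Definition unip z := sl2 1 z 0 1.
Definition diag2 a := sl2 a 0 0 a^-1.
Definition weyl2 := sl2 0 1 (-1) 0.

Lemma unip_in z : unip z \in SL2 F.
Proof. by apply: sl2_in; ring. Qed.

Lemma unipD z s : unip (z + s) = (unip z * unip s)%g.
Proof. by rewrite /unip sl2M; [congr sl2; ring | ring | ring]. Qed.

Lemma diag2_in a : a != 0 -> diag2 a \in SL2 F.
Proof. by move=> a0; apply: sl2_in; field. Qed.

Lemma diag2_unip a z : a != 0 ->
  (diag2 a * unip z = unip (a ^+ 2 * z)%R * diag2 a)%g.
Proof.
by move=> a0; rewrite /unip /diag2 !sl2M; try (field => //); congr sl2; field.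
Qed.

Lemma weyl2_in : weyl2 \in SL2 F.
Proof. by apply: sl2_in; ring. Qed.

Lemma weyl2V : weyl2^-1%g = sl2 0 (-1) 1 0.
Proof.
apply: (mulgI weyl2); rewrite mulgV /weyl2 sl2M; try ring.
rewrite [LHS]SL2_eta ?group1 // GL_1E !mxE /=; congr sl2; ring.
Qed.

Lemma big_cellE z s s' :
  (unip s * (weyl2 * unip z * weyl2^-1) * unip s')%g
   = sl2 (1 - s * z) (s' * (1 - s * z) + s) (- z) (1 - z * s').
Proof. by rewrite weyl2V /weyl2 /unip !sl2M; try ring; congr sl2; ring. Qed.

Definition borel_set : {set {'GL_2[F]}} := [set x in SL2 F | GLval x 1 0 == 0].

Lemma in_borel x : (x \in borel_set) = (x \in SL2 F) && (GLval x 1 0 == 0).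
Proof. by rewrite inE. Qed.

Lemma borel_group_set : group_set borel_set.
Proof.
apply/group_setP; split; first by rewrite in_borel group1 GL_1E !mxE /=.
move=> x y; rewrite !in_borel => /andP[xG /eqP x0] /andP[yG /eqP y0].
rewrite groupM // andTb GL_MxE [GLval x]mx2_eta [GLval y]mx2_eta mulmx2 !mxE /=.
by rewrite x0 y0 mul0r mulr0 addr0.
Qed.

Canonical borel : {group {'GL_2[F]}} := Group borel_group_set.

Lemma borel_sub : borel \subset SL2 F.
Proof. by apply/subsetP => x; rewrite in_borel => /andP[]. Qed.

(** Bruhat decomposition. By [big_cellE] the lower left entry gives [z], the diagonal entries then
    give [s] and [s'], and the determinant fixes the upper right entry. *)
Lemma sum_big_cell (R : realFieldType) (psi : {'GL_2[F]} -> R) :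
  \sum_(y in SL2 F :\: borel) psi y
    = \sum_(z | z != 0) \sum_s \sum_s'
        psi (unip s * (weyl2 * unip z * weyl2^-1) * unip s')%g.
Proof.
under [RHS]eq_bigr do rewrite pair_big.
rewrite pair_big /=.
pose to (p : F * (F * F)) :=
  (unip p.2.1 * (weyl2 * unip p.1 * weyl2^-1) * unip p.2.2)%g.
pose from y := let z := - GLval y 1 0 in
  (z, ((1 - GLval y 0 0) / z, (1 - GLval y 1 1) / z)).
rewrite (reindex_onto to from) => [|y]; last first.
  rewrite in_setD in_borel => /andP[yB yG]; move: yB; rewrite yG /= => y0.
  have := SL2_det yG.
  rewrite /to /from /= big_cellE => h; rewrite [RHS](SL2_eta yG).
  have -> : GLval y 0 1 = (GLval y 0 0 * GLval y 1 1 - 1) / GLval y 1 0.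
    by rewrite -h; field.
  by congr sl2; field; rewrite ?oppr_eq0 ?y0.
apply: eq_big => [[z [s s']]|p _] //=.
have detE : (1 - s * z) * (1 - z * s') - (s' * (1 - s * z) + s) * (- z) = 1 by ring.
rewrite /to /= big_cellE in_setD in_borel sl2_in // val_sl2 // /from !val_sl2 // !mxE /= opprK oppr_eq0.
rewrite !andbT; case: eqP => //= /eqP z0.
by apply/eqP; congr (_, (_, _)); field.
Qed.

End SL2Elements.

(** * Centralisers, trace conditions and the energy of subsets of a class *)

Section Counting.
Context (F : finFieldType).

(** On each of the [#|F|] possible fibres of [k], the injective coordinate [p] is a root of one
    monic quadratic. *)
Lemma card_quadratic_fibers_le (T : finType) (Z : {set T}) (k p : T -> F) (b c : F -> F) :
  (forall z : T, z \in Z -> p z ^+ 2 + b (k z) * p z = c (k z)) ->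
  {in Z &, forall z z' : T, k z = k z' -> p z = p z' -> z = z'} ->
  (#|Z| <= 2 * #|F|)%N.
Proof.
move=> hquad hinj; rewrite -sum1_card (partition_big k predT) //= mulnC -sum_nat_const.
apply: leq_sum => r _; rewrite sum1dep_card.
have [x|no] := pickP [pred x | (x \in Z) && (k x == r)]; last first.
  by rewrite (_ : [set _ | _] = set0) ?cards0 //; apply/setP => x; rewrite !inE; exact: no.
case/andP=> xZ /eqP xr; set Y := [set _ | _].
have YP y : y \in Y -> y \in Z /\ k y = r by rewrite inE => /andP[? /eqP].
have p_inj : {in Y &, injective p}.
  by move=> y z /YP[yZ yr] /YP[zZ zr]; apply: hinj => //; rewrite yr zr.
rewrite -(card_in_imset p_inj).
(* Once [p x] is a root, Vieta gives the other one as [- b r - p x]. *)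
apply: leq_trans (subset_leq_card (_ : _ \subset [set p x; - b r - p x])) _.
  apply/subsetP => _ /imsetP[y /YP[yZ yr] ->].
  have : (p y - p x) * (p y - (- b r - p x)) = 0.
    have := hquad y yZ; have := hquad x xZ; rewrite xr yr => <- e.
    have -> : (p y - p x) * (p y - (- b r - p x))
      = (p y ^+ 2 + b r * p y) - (p x ^+ 2 + b r * p x) by ring.
    by rewrite e subrr.
  by move/eqP; rewrite mulf_eq0 !subr_eq0 !inE.
by rewrite cards2; case: (_ != _).
Qed.

Implicit Types (x y a s : {'GL_2[F]}).

Definition scalar2 x := [&& GLval x 0 1 == 0, GLval x 1 0 == 0 & GLval x 0 0 == GLval x 1 1].

(** A scalar matrix of determinant one is 1 or -1. *)
Lemma card_scalar2_le : (#|[set x in SL2 F | scalar2 x]| <= 2)%N.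
Proof.
pose f x := GLval x 0 0.
have f_inj : {in [set x in SL2 F | scalar2 x] &, injective f}.
  move=> x y; rewrite !in_set => /andP[_ /and3P[/eqP x1 /eqP x2 /eqP x3]].
  move=> /andP[_ /and3P[/eqP y1 /eqP y2 /eqP y3]] e.
  by apply: GL2_eqP; rewrite ?x1 ?x2 -?x3 ?y1 ?y2 -?y3.
rewrite -(card_in_imset f_inj).
apply: leq_trans (subset_leq_card (_ : _ \subset [set 1; -1])) _; last first.
  by rewrite cards2; case: (_ != _).
apply/subsetP => _ /imsetP[x + ->]; rewrite in_set => /andP[/SL2_det h /and3P[/eqP x1 _ /eqP x3]].
by rewrite !inE -eqf_sqr expr1n -h x1 -x3 mul0r subr0 expr2.
Qed.

Lemma scalar2N x : ~~ scalar2 x ->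
  [\/ GLval x 1 0 != 0, GLval x 0 1 != 0 |
    [/\ GLval x 0 1 = 0, GLval x 1 0 = 0 & GLval x 0 0 - GLval x 1 1 != 0]].
Proof.
rewrite /scalar2; have [e2|] := eqVneq (GLval x 1 0) 0; last by constructor 1.
have [e1|] := eqVneq (GLval x 0 1) 0; last by constructor 2.
by move=> /= h; constructor 3; rewrite subr_eq0.
Qed.

Lemma GL2_mul00 x y : GLval (x * y)%g 0 0 = GLval x 0 0 * GLval y 0 0 + GLval x 0 1 * GLval y 1 0.
Proof. by rewrite GL_MxE {1}[GLval x]mx2_eta {1}[GLval y]mx2_eta mulmx2 mxE. Qed.

Lemma GL2_mul01 x y : GLval (x * y)%g 0 1 = GLval x 0 0 * GLval y 0 1 + GLval x 0 1 * GLval y 1 1.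
Proof. by rewrite GL_MxE {1}[GLval x]mx2_eta {1}[GLval y]mx2_eta mulmx2 mxE. Qed.

Lemma GL2_mul10 x y : GLval (x * y)%g 1 0 = GLval x 1 0 * GLval y 0 0 + GLval x 1 1 * GLval y 1 0.
Proof. by rewrite GL_MxE {1}[GLval x]mx2_eta {1}[GLval y]mx2_eta mulmx2 mxE. Qed.

Lemma GL2_mul11 x y : GLval (x * y)%g 1 1 = GLval x 1 0 * GLval y 0 1 + GLval x 1 1 * GLval y 1 1.
Proof. by rewrite GL_MxE {1}[GLval x]mx2_eta {1}[GLval y]mx2_eta mulmx2 mxE. Qed.

Lemma eq_sub_eq (V : zmodType) (a b c d : V) : a = b -> c - d = a - b -> c = d.
Proof. by move=> -> h; apply/eqP; rewrite -subr_eq0 h subrr. Qed.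

(** Commuting with [s] is linear in the entries of [y]. A nonzero off-diagonal entry of [s]
    expresses two entries of [y] through the other two, and the determinant becomes a monic
    quadratic in the upper left entry. If [s] is diagonal but not scalar, its centraliser is
    diagonal. *)
Lemma card_cent_SL2_le s : ~~ scalar2 s -> (#|'C_(SL2 F)[s]%g| <= 2 * #|F|)%N.
Proof.
move=> sN.
have ZP y : y \in 'C_(SL2 F)[s]%g -> [/\ y \in SL2 F,
    GLval y 0 1 * GLval s 1 0 = GLval s 0 1 * GLval y 1 0,
    GLval s 0 1 * (GLval y 0 0 - GLval y 1 1) = (GLval s 0 0 - GLval s 1 1) * GLval y 0 1 &
    GLval s 1 0 * (GLval y 0 0 - GLval y 1 1) = (GLval s 0 0 - GLval s 1 1) * GLval y 1 0].
  rewrite in_setI => /andP[yG /cent1P e].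
  have := congr1 (fun x => GLval x 0 0) e; have := congr1 (fun x => GLval x 0 1) e.
  have := congr1 (fun x => GLval x 1 0) e.
  rewrite !GL2_mul00 !GL2_mul01 !GL2_mul10 => e3 e2 e1; split=> //.
  - by apply: (eq_sub_eq e1); ring.
  - by apply: (eq_sub_eq e2); ring.
  - by apply: (eq_sub_eq (esym e3)); ring.
case: (scalar2N sN) => [c0|b0|[b0 c0 d0]].
- have q1 y : y \in 'C_(SL2 F)[s]%g -> GLval y 0 1 = GLval s 0 1 * GLval y 1 0 / GLval s 1 0.
    by case/ZP=> _ <- _ _; field.
  have q2 y : y \in 'C_(SL2 F)[s]%g ->
      GLval y 1 1 = GLval y 0 0 - (GLval s 0 0 - GLval s 1 1) * GLval y 1 0 / GLval s 1 0.
    by case/ZP=> _ _ _ <-; field.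
  apply: (card_quadratic_fibers_le (k := fun y => GLval y 1 0) (p := fun y => GLval y 0 0)
    (b := fun r => - (GLval s 0 0 - GLval s 1 1) * r / GLval s 1 0)
    (c := fun r => 1 + GLval s 0 1 * r ^+ 2 / GLval s 1 0)).
  + move=> y yZ; have [/SL2_det h _ _ _] := ZP y yZ.
    by rewrite -h (q1 y yZ) (q2 y yZ); field.
  + move=> x y xZ yZ e1 e2; apply: GL2_eqP; [exact: e2
      | by rewrite (q1 x xZ) (q1 y yZ) e1
      | exact: e1
      | by rewrite (q2 x xZ) (q2 y yZ) e1 e2].
- have q1 y : y \in 'C_(SL2 F)[s]%g -> GLval y 1 0 = GLval s 1 0 * GLval y 0 1 / GLval s 0 1.
    by case/ZP=> _ e _ _; rewrite [_ * GLval y 0 1]mulrC e; field.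
  have q2 y : y \in 'C_(SL2 F)[s]%g ->
      GLval y 1 1 = GLval y 0 0 - (GLval s 0 0 - GLval s 1 1) * GLval y 0 1 / GLval s 0 1.
    by case/ZP=> _ _ <- _; field.
  apply: (card_quadratic_fibers_le (k := fun y => GLval y 0 1) (p := fun y => GLval y 0 0)
    (b := fun r => - (GLval s 0 0 - GLval s 1 1) * r / GLval s 0 1)
    (c := fun r => 1 + GLval s 1 0 * r ^+ 2 / GLval s 0 1)).
  + move=> y yZ; have [/SL2_det h _ _ _] := ZP y yZ.
    by rewrite -h (q1 y yZ) (q2 y yZ); field.
  + move=> x y xZ yZ e1 e2; apply: GL2_eqP; [exact: e2
      | exact: e1
      | by rewrite (q1 x xZ) (q1 y yZ) e1
      | by rewrite (q2 x xZ) (q2 y yZ) e1 e2].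
- have q1 y : y \in 'C_(SL2 F)[s]%g -> GLval y 0 1 = 0.
    case/ZP=> _ _ + _; rewrite b0 mul0r => /esym/eqP.
    by rewrite mulf_eq0 (negbTE d0) => /eqP.
  have q2 y : y \in 'C_(SL2 F)[s]%g -> GLval y 1 0 = 0.
    case/ZP=> _ _ _; rewrite c0 mul0r => /esym/eqP.
    by rewrite mulf_eq0 (negbTE d0) => /eqP.
  (* Here [y] is diagonal, so the quadratic is just [p ^+ 2 = 0]; the upper left entry determines
     [y] through the determinant. *)
  apply: (card_quadratic_fibers_le (k := fun y => GLval y 0 0) (p := fun y => GLval y 0 1)
    (b := fun=> 0) (c := fun=> 0)) => [y yZ|x y xZ yZ e1 _].
    by rewrite q1 // mul0r addr0 expr0n.
  apply: GL2_eqP; [exact: e1 | by rewrite (q1 x xZ) (q1 y yZ)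
    | by rewrite (q2 x xZ) (q2 y yZ) |].
  have [/SL2_det hx _ _ _] := ZP x xZ; have [/SL2_det hy _ _ _] := ZP y yZ.
  move: hx hy; rewrite (q1 x xZ) (q1 y yZ) !mul0r !subr0 -e1 => hx hy.
  have x0 : GLval x 0 0 != 0 by apply: contraTneq (oner_neq0 F) => e; rewrite -hx e mul0r eqxx.
  by apply: (mulfI x0); rewrite hx hy.
Qed.

(** Both trace conditions are linear in the entries of [a]: the first eliminates the lower right
    entry and the second, when [x] is not diagonal, an off-diagonal one. For each value of the other
    off-diagonal entry, the determinant condition is a quadratic in the upper left entry. *)
Lemma card_trace_pencil_le x (tau : F) : ~~ scalar2 x ->
  (#|[set a in SL2 F | (\tr (GLval a) == tau) && (\tr (GLval (a * x)%g) == tau)]| <= 2 * #|F|)%N.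
Proof.
move=> xN; set Z := [set _ in _ | _].
have tr2 (M : 'M[F]_2) : \tr M = M 0 0 + M 1 1.
  rewrite /mxtrace !big_ord_recl big_ord0 addr0; congr (M _ _ + M _ _); exact: val_inj.
have ZP a : a \in Z -> [/\ a \in SL2 F, GLval a 1 1 = tau - GLval a 0 0 &
    GLval a 0 1 * GLval x 1 0 + GLval a 1 0 * GLval x 0 1 =
      tau - GLval a 0 0 * GLval x 0 0 - (tau - GLval a 0 0) * GLval x 1 1].
  rewrite in_set !tr2 GL2_mul00 GL2_mul11 => /and3P[aG /eqP e1 /eqP e2].
  have e3 : GLval a 1 1 = tau - GLval a 0 0 by rewrite -e1; ring.
  by split=> //; rewrite -e3 -e2; ring.
case: (scalar2N xN) => [c0|b0|[b0 c0 d0]].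
- have q1 a : a \in Z -> GLval a 0 1 = (tau - GLval a 0 0 * GLval x 0 0
      - (tau - GLval a 0 0) * GLval x 1 1 - GLval a 1 0 * GLval x 0 1) / GLval x 1 0.
    by case/ZP=> _ _ <-; field.
  apply: (card_quadratic_fibers_le (k := fun a => GLval a 1 0) (p := fun a => GLval a 0 0)
    (b := fun r => - (tau + r * (GLval x 0 0 - GLval x 1 1) / GLval x 1 0))
    (c := fun r => -1 - r / GLval x 1 0 *
       (tau - tau * GLval x 1 1 - r * GLval x 0 1))).
  + move=> a aZ; have [/SL2_det h e _] := ZP a aZ.
    by rewrite -h (q1 a aZ) e; field.
  + move=> a a' aZ a'Z e1 e2; have [_ e _] := ZP a aZ; have [_ e' _] := ZP a' a'Z.
    apply: GL2_eqP; [exact: e2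
      | by rewrite (q1 a aZ) (q1 a' a'Z) e1 e2
      | exact: e1
      | by rewrite e e' e2].
- have q1 a : a \in Z -> GLval a 1 0 = (tau - GLval a 0 0 * GLval x 0 0
      - (tau - GLval a 0 0) * GLval x 1 1 - GLval a 0 1 * GLval x 1 0) / GLval x 0 1.
    by case/ZP=> _ _ <-; field.
  apply: (card_quadratic_fibers_le (k := fun a => GLval a 0 1) (p := fun a => GLval a 0 0)
    (b := fun r => - (tau + r * (GLval x 0 0 - GLval x 1 1) / GLval x 0 1))
    (c := fun r => -1 - r / GLval x 0 1 *
       (tau - tau * GLval x 1 1 - r * GLval x 1 0))).
  + move=> a aZ; have [/SL2_det h e _] := ZP a aZ.
    by rewrite -h (q1 a aZ) e; field.
  + move=> a a' aZ a'Z e1 e2; have [_ e _] := ZP a aZ; have [_ e' _] := ZP a' a'Z.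
    apply: GL2_eqP; [exact: e2
      | exact: e1
      | by rewrite (q1 a aZ) (q1 a' a'Z) e1 e2
      | by rewrite e e' e2].
- pose p0 := (tau - tau * GLval x 1 1) / (GLval x 0 0 - GLval x 1 1).
  have q1 a : a \in Z -> GLval a 0 0 = p0.
    case/ZP=> _ _ ; rewrite b0 c0 !mulr0 addr0 => /esym e.
    apply: (mulIf d0); rewrite /p0 divfK //.
    by apply/eqP; rewrite -subr_eq0 -oppr_eq0 -e; apply/eqP; ring.
  (* here the off-diagonal entries have a fixed product, so each is a root of
     a monic quadratic whose linear coefficient is minus their sum *)
  apply: (card_quadratic_fibers_le (k := fun a => GLval a 0 1 + GLval a 1 0)
    (p := fun a => GLval a 0 1) (b := fun r => - r)
    (c := fun=> 1 - p0 * (tau - p0))).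
  + move=> a aZ; have [/SL2_det h e _] := ZP a aZ.
    by rewrite -h -(q1 a aZ) e; ring.
  + move=> a a' aZ a'Z e1 e2; have [_ e _] := ZP a aZ; have [_ e' _] := ZP a' a'Z.
    apply: GL2_eqP; [by rewrite (q1 a aZ) (q1 a' a'Z) | exact: e2 | |
      by rewrite e e' (q1 a aZ) (q1 a' a'Z)].
    by move: e1; rewrite e2 => /addrI.
Qed.

Lemma trace_conj x y : \tr (GLval (x ^ y)%g) = \tr (GLval x).
Proof. by rewrite conjgE GL_MxE mxtrace_mulC -GL_MxE mulgK. Qed.

(** Orbit-stabiliser, with the bound on the centraliser. *)
Lemma card_class_SL2 s : s \in SL2 F -> ~~ scalar2 s ->
  (#|SL2 F| <= 2 * #|F| * #|(s ^: SL2 F)%g|)%N.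
Proof.
move=> sG sN; rewrite -index_cent1 -(Lagrange (subsetIl (SL2 F) 'C[s]%g)).
exact: leq_mul (card_cent_SL2_le sN) (leqnn _).
Qed.

Lemma card_SL2_ge : (#|F| ^ 3 <= 2 * #|SL2 F|)%N.
Proof.
have e : (#|SL2 F :\: borel F| = #|F|.-1 * #|F| * #|F|)%N.
  (* Summing the constant 1 over the big cell counts it; the rationals serve as the field of
     values. *)
  apply/eqP; rewrite -(eqr_nat rat) -sum1_card natr_sum sum_big_cell.
  rewrite !sumr_const cardC1 -!mulrnA [X in _ == X%:R]mulnC [(_.-1 * _)%N]mulnC.
  by rewrite mul1n; exact: eqxx.
have : (#|SL2 F :\: borel F| <= #|SL2 F|)%N by rewrite subset_leq_card ?subsetDl.
rewrite e => h; apply: leq_trans (leq_mul (leqnn 2) h).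
rewrite !mulnA expnSr -mulnn leq_mul2r; apply/orP; right; rewrite leq_mul2r; apply/orP; right.
have : (1 < #|F|)%N := card_finNzRing_gt1 F.
by rewrite mul2n -addnn; case: #|F| => [|[|m]] //= _; rewrite addSn ltnS leq_addl.
Qed.

(** The at most two scalar [x] contribute at most [#|A| ^ 2] each. For the others [r x] is at most
    [2 * #|F|], since the trace is constant on a class, and all [r x] sum to [#|A| ^ 2]. *)
Lemma class_energy_le (R : realFieldType) s (A : {set {'GL_2[F]}}) :
  s \in SL2 F -> A \subset (s ^: SL2 F)%g ->
  \sum_(x in SL2 F) #|[set a in A | (a * x)%g \in A]|%:R ^+ 2
    <= 4 * #|F|%:R * #|A|%:R ^+ 2 :> R.
Proof.
move=> sG sA; pose r x := #|[set a in A | (a * x)%g \in A]|.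
have AG : A \subset SL2 F.
  apply: subset_trans sA _; apply/subsetP => _ /imsetP[y yG ->].
  by rewrite groupJ.
have Atr a : a \in A -> \tr (GLval a) = \tr (GLval s).
  by move=> /(subsetP sA) /imsetP[y _ ->]; rewrite trace_conj.
have r_leA x : (r x <= #|A|)%N.
  by apply: subset_leq_card; apply/subsetP => a; rewrite inE => /andP[].
have r_le x : ~~ scalar2 x -> (r x <= 2 * #|F|)%N.
  move=> xN; apply: leq_trans (card_trace_pencil_le (\tr (GLval s)) xN).
  apply: subset_leq_card; apply/subsetP => a; rewrite in_set => /andP[aA axA].
  by rewrite in_set (subsetP AG _ aA) (Atr _ aA) (Atr _ axA) eqxx.
have r_sum : (\sum_x r x = #|A| * #|A|)%N.
  transitivity (\sum_x \sum_(a in A) ((a * x)%g \in A))%N.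
    apply: eq_bigr => x _; rewrite /r -sum1dep_card [LHS]big_mkcondr /=.
    by apply: eq_bigr => a _; case: (_ \in A).
  rewrite exchange_big -sum_nat_const; apply: eq_bigr => a _ /=.
  rewrite -sum1_card [RHS]big_mkcond [RHS](reindex_inj (mulgI a)) /=.
  by apply: eq_bigr => x _; case: (_ \in A).
suff : (\sum_(x in SL2 F) r x ^ 2 <= 4 * #|F| * #|A| ^ 2)%N.
  move=> h; under eq_bigr do rewrite -natrX.
  by rewrite -natr_sum -natrX -!natrM ler_nat.
rewrite (bigID scalar2) /=.
have q0 : (0 < #|F|)%N by apply: ltnW; exact: card_finNzRing_gt1.
apply: (@leq_trans (2 * #|A| ^ 2 + 2 * #|F| * #|A| ^ 2)); last first.
  rewrite -mulnDl leq_mul2r; apply/orP; right.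
  by rewrite (mulnDl 2 2) leq_add2r leq_pmulr.
apply: leq_add.
  apply: (@leq_trans (\sum_(x | (x \in SL2 F) && scalar2 x) #|A| ^ 2)).
    by apply: leq_sum => x _; rewrite leq_exp2r.
  rewrite sum_nat_const leq_mul2r; apply/orP; right.
  by apply: leq_trans card_scalar2_le; rewrite cardsE.
rewrite -mulnn -r_sum big_distrr /= [X in (_ <= X)%N](bigID (fun x => (x \in SL2 F) && ~~ scalar2 x)) /=.
apply: leq_trans (leq_addr _ _); apply: leq_sum => x /andP[_ xN].
by rewrite -mulnn leq_mul2r r_le ?orbT.
Qed.
End Counting.

(** * The deviation bound in SL(2,q) and its probabilistic form *)

Lemma SL2_triple_count_dev_le (R : realFieldType) (F : finFieldType) (y : R)
    (s : {'GL_2[F]}) (A B D : {set {'GL_2[F]}}) (g : {'GL_2[F]}) :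
  0 < y -> y ^+ 12 * #|SL2 F|%:R = 1 ->
  s \in SL2 F -> ~~ scalar2 s -> A \subset (s ^: SL2 F)%g ->
  B \subset SL2 F -> D \subset SL2 F -> g \in SL2 F ->
  `|(triple_count A B D g)%:R - #|A|%:R * #|B|%:R * #|D|%:R / #|SL2 F|%:R|
    <= 6 * #|(s ^: SL2 F)%g|%:R * #|SL2 F|%:R * y.
Proof.
move=> y0 yn sG sN sA sB sD gG.
pose n : R := #|SL2 F|%:R; pose q : R := #|F|%:R; pose S : R := #|(s ^: SL2 F)%g|%:R.
have n0 : 0 < n by rewrite ltr0n cardG_gt0.
have q0 : 0 < q := card_field_gt0 R F.
have S0 : 0 <= S by rewrite ler0n.
have AG : A \subset SL2 F.
  by apply: subset_trans sA _; apply/subsetP => _ /imsetP[x xG ->]; rewrite groupJ.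
have hQ (f : {'GL_2[F]} -> R) : \sum_(x in SL2 F) f x = 0 ->
    \sum_(x in SL2 F) corr (SL2 F) f f x ^+ 2 <= 27 * n / q * norm2 (SL2 F) f ^+ 2.
  move=> f0; rewrite -(ler_pM2l q0).
  have := sum_corr_sq_quasirandom (@unip_in F) (@unipD F) (@diag2_in F) (@diag2_unip F)
    (borel_sub F) (weyl2_in F) (@sum_big_cell F R) f0.
  by rewrite -/q -/n => h; apply: le_trans h _; rewrite le_eqVlt; apply/orP; left;
    apply/eqP; field; rewrite gt_eqF.
have Q0 : 0 <= 27 * n / q by rewrite divr_ge0 ?mulr_ge0 ?ler0n ?ltW.
have dev4 := triple_count_dev_le Q0 hQ AG sB sD gG.
have En := class_energy_le R sG sA.
have leS : #|A|%:R <= S by rewrite ler_nat subset_leq_card.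
have leB : #|B|%:R <= n by rewrite ler_nat subset_leq_card.
have leD : #|D|%:R <= n by rewrite ler_nat subset_leq_card.
have hS : n <= 2 * q * S by rewrite -!natrM ler_nat card_class_SL2.
have hq : q ^+ 3 <= 2 * n by rewrite -natrX -natrM ler_nat card_SL2_ge.
(* [y] plays the role of [n ^ (-1/12)], so [n * y ^+ 4] is [n ^ (2/3)]. After cubing, the claim
   follows from [q ^+ 6 <= 4 * n ^+ 2] and 4 <= 27. *)
have q2 : q ^+ 2 <= 3 * n * y ^+ 4.
  have yn0 : 0 <= 3 * n * y ^+ 4 by rewrite mulr_ge0 ?exprn_ge0 ?mulr_ge0 ?ler0n ?ltW.
  rewrite -(ler_pXn2r (n := 3)) ?nnegrE ?sqr_ge0 //.
  have -> : (3 * n * y ^+ 4) ^+ 3 = 27 * n ^+ 2 * (y ^+ 12 * n) by ring.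
  rewrite yn mulr1 -exprM (_ : 2 * 3 = 3 * 2)%N // exprM.
  have : (q ^+ 3) ^+ 2 <= (2 * n) ^+ 2.
    by rewrite ler_sqr // nnegrE ?exprn_ge0 ?mulr_ge0 ?ler0n ?ltW.
  have := sqr_ge0 n; rewrite exprMn; lra.
(* Combine [n ^+ 2 <= 4 * q ^+ 2 * S ^+ 2] with [q2] and cancel [n]. *)
have nS : n <= 12 * S ^+ 2 * y ^+ 4.
  have q20 : 0 < 4 * q ^+ 2 by rewrite mulr_gt0 ?ltr0n ?exprn_gt0.
  rewrite -(ler_pM2l q20).
  have h1 : n ^+ 2 <= (2 * q * S) ^+ 2.
    by rewrite ler_sqr // nnegrE ?mulr_ge0 ?ler0n ?ltW.
  have y4 : 0 <= 12 * y ^+ 4 by rewrite mulr_ge0 ?ler0n ?exprn_ge0 ?ltW.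
  have h2 := ler_wpM2l y4 h1.
  have n4 : 0 <= 4 * n by rewrite mulr_ge0 ?ler0n ?ltW.
  have h3 := ler_wpM2l n4 q2; lra.
have rhs0 : 0 <= 6 * S * n * y by rewrite !mulr_ge0 ?ler0n ?ltW.
rewrite -(ler_pXn2r (n := 4)) ?nnegrE ?normr_ge0 //.
rewrite -normrX ger0_norm; last by rewrite (_ : 4 = 2 * 2)%N // exprM sqr_ge0.
apply: le_trans dev4 _.
have sqle (u v : R) : 0 <= u -> u <= v -> u ^+ 2 <= v ^+ 2.
  by move=> u0 uv; rewrite ler_sqr ?nnegrE // (le_trans u0).
(* The [q] of the energy cancels the [1 / q] of quasirandomness, leaving [108 * n ^+ 5 * S ^+ 2]. By
   [nS] one factor [n] becomes [12 * S ^+ 2 * y ^+ 4], and 108 times 12 is the fourth power of 6. *)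
apply: (@le_trans _ _ (n ^+ 2 * (4 * q * S ^+ 2) * (27 * n / q * n ^+ 2))).
  apply: ler_pM.
  - by rewrite mulr_ge0 ?sqr_ge0 //; apply: sumr_ge0 => x _; rewrite sqr_ge0.
  - by rewrite mulr_ge0 ?sqr_ge0.
  - apply: ler_pM; rewrite ?sqr_ge0 ?sqle ?ler0n //.
      by apply: sumr_ge0 => x _; rewrite sqr_ge0.
    apply: le_trans En _; rewrite ler_wpM2l ?mulr_ge0 ?ler0n //.
    by rewrite sqle ?ler0n.
  - by rewrite ler_wpM2l // sqle ?ler0n.
have -> : n ^+ 2 * (4 * q * S ^+ 2) * (27 * n / q * n ^+ 2)
   = 108 * n ^+ 4 * S ^+ 2 * n by field; rewrite gt_eqF.
have -> : (6 * #|(s ^: SL2 F)%g|%:R * #|SL2 F|%:R * y) ^+ 4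
   = 108 * n ^+ 4 * S ^+ 2 * (12 * S ^+ 2 * y ^+ 4) by rewrite -/n -/S; ring.
by rewrite ler_wpM2l // !mulr_ge0 ?ler0n ?sqr_ge0 ?exprn_ge0 ?ltW.
Qed.

(** Divide by [a * b * d]; the product of the three densities is [a * b * d / (S * n ^+ 2)]. *)
Lemma count_dev_to_prob_dev (R : realFieldType) (N a b d S n k y : R) :
  0 < a -> 0 < b -> 0 < d -> 0 < S -> 0 < n ->
  `|N - a * b * d / n| <= k * S * n * y ->
  `|N / (a * b * d) - 1 / n| <= k / (a / S * (b / n) * (d / n)) * y * (1 / n).
Proof.
move=> a0 b0 d0 S0 n0 h.
have abd : 0 < (a * b * d)^-1 by rewrite invr_gt0 !mulr_gt0.
have -> : N / (a * b * d) - 1 / n = (N - a * b * d / n) * (a * b * d)^-1.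
  by field; rewrite !gt_eqF.
have -> : k / (a / S * (b / n) * (d / n)) * y * (1 / n)
    = k * S * n * y * (a * b * d)^-1.
  by field; rewrite !gt_eqF.
by rewrite normrM (gtr0_norm abd) ler_pM2r.
Qed.

Open Scope R_scope.

Theorem mainTheorem6 :
  exists (K : nat) (C c : R), 0 < C /\ 0 < c /\
  forall F : finFieldType,
    exists E : {set {set {'GL_2[F]}}}, leq #|E| K /\
    forall S : {set {'GL_2[F]}}, S \in classes (SL2 F) -> S \notin E ->
    forall A B D : {set {'GL_2[F]}},
      A \subset S -> A != set0 ->
      B \subset SL2 F -> B != set0 ->
      D \subset SL2 F -> D != set0 ->
      let nG := INR #|SL2 F| in
      let alpha := INR #|A| / INR #|S| in
      let beta := INR #|B| / nG in
      let gamma := INR #|D| / nG in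
      forall g : {'GL_2[F]}, g \in SL2 F ->
        Rabs (INR (triple_count A B D g) / (INR #|A| * INR #|B| * INR #|D|) - 1 / nG)
        <= C * / (alpha * beta * gamma) * Rpower nG (- c) * (1 / nG).
Proof.
(* 2 bounds the number of scalar classes. Relative to [#|S| * nG], the fourth power of the deviation
   is at most 1296 times the power -1/3 of [nG]; fourth roots give 6 and 1/12. *)
exists 2%N, 6, (/ 12); split; [|split].
- by apply: IZR_lt.
- by apply: Rinv_0_lt_compat; apply: IZR_lt.
move=> F; exists [set x ^: SL2 F | x in [set x in SL2 F | scalar2 x]]%g.
split; first exact: leq_trans (leq_imset_card _ _) (card_scalar2_le F).
move=> S /imsetP[s sG ->] sE A B D sA A0 sB B0 sD D0 nG alpha beta gamma g gG.
have sN : ~~ scalar2 s.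
  by apply: contra sE => ss; apply: imset_f; rewrite in_set sG.
have nG0 : 0 < nG by apply/RltP; rewrite /nG INRE ltr0n cardG_gt0.
pose y := Rpower nG (- / 12).
have y0 : 0 < y by apply: exp_pos.
have yn : y ^ 12 * nG = 1.
  rewrite -Rpower_pow // Rpower_mult -[X in _ * X](Rpower_1 nG) // -Rpower_plus.
  rewrite (_ : _ + 1 = 0) ?Rpower_O // !INR_IZR_INZ /=.
  by rewrite Ropp_mult_distr_l_reverse Rinv_l ?Rplus_opp_l //; apply/eqP; rewrite IZR_neq.
have pos (X : {set {'GL_2[F]}}) : X != set0 -> (0 < #|X|%:R :> R)%R.
  by rewrite ltr0n card_gt0.
have S0 : (s ^: SL2 F)%g != set0 by apply/set0Pn; exists s; exact: class_refl.
have yn' : (y ^+ 12 * #|SL2 F|%:R = 1)%R by rewrite -INRE -RpowE.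
have h := SL2_triple_count_dev_le (introT RltP y0) yn' sG sN sA sB sD gG.
apply/RleP; rewrite /alpha /beta /gamma -/y /nG !RealsE.
apply: (count_dev_to_prob_dev _ _ _ _ _ h); try exact: pos.
by rewrite ltr0n cardG_gt0.
Qed.
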